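(* Let $(\Sigma,\sigma)$ be an infinite minimal subshift. Then there are a minimal subshift $(\hat\Sigma,\sigma)$ and an almost $1$-to-$1$ factor map $\pi\colon(\hat\Sigma,\sigma)\to(\Sigma,\sigma)$ with $|\pi^{-1}(x)|\le 3$ for all $x\in\Sigma$ such that, with $$D=\{x\in\Sigma\colon \text{there are } y,z\in\pi^{-1}(x)\text{ with } y_0\ne z_0\},$$ we have $$\{0\}\subsetneq S_D\neq\big[0,\sup_\mu\mu(D)\big],$$ where the supremum is taken over all invariant measures $\mu$ of $(\Sigma,\sigma)$.
   Context: A subshift is a pair $(\Sigma,\sigma)$ where $\Sigma\subseteq\mathcal A^{\mathbb Z}$ is closed (product topology) and shift-invariant for some finite alphabet $\mathcal A$, and $\sigma$ is the left shift; it is minimal if every $\sigma$-orbit $\{\sigma^\ell x\colon \ell\in\mathbb Z\}$ is dense. A factor map is a continuous surjection $\pi$ with $\pi\circ\sigma=\sigma\circ\pi$; for minimal subshifts it is almost $1$-to-$1$ if there is $x\in\Sigma$ with $|\pi^{-1}(x)|=1$. An invariant measure is a Borel probability measure $\mu$ with $\mu(A)=\mu(\sigma A)$ for all Borel sets $A$. For $D\subseteq\Sigma$, $x\in\Sigma$ and $n\in\mathbb N=\{1,2,\ldots\}$ put $S_D^n(x)=\frac1n\sum_{i=0}^{n-1}\mathbf 1_D(\sigma^i x)$, and $$S_D=\bigcup_{x\in\Sigma}\ \bigcap_{N\in\mathbb N}\overline{\{S_D^n(x)\colon n\ge N\}}.$$ *)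

(* Defs.v *)
From HB Require Import structures.
From mathcomp Require Import all_boot all_order all_algebra.
From mathcomp Require Import all_classical all_reals all_analysis.
Import Order.TTheory GRing.Theory Num.Theory.
Import numFieldNormedType.Exports.

Set Implicit Arguments.
Unset Strict Implicit.
Unset Printing Implicit Defensive.

Local Open Scope classical_set_scope.
Local Open Scope card_scope.
Local Open Scope ring_scope.

Definition full_shift (A : finType) : Type :=
  prod_topology (fun _ : int => discrete_topology A).

HB.instance Definition _ (A : finType) :=
  Topological.copy (full_shift A)
    (prod_topology (fun _ : int => discrete_topology A)).

(* The [l]-th power of the left shift on the two-sided full shift. *)
Definition shift_by (A : finType) (l : int) (x : full_shift A) : full_shift A :=
  fun i => x (i + l).

(* Nonemptiness is required because measurable types in the library are
   pointed, and the points of a subshift are to carry a Borel structure.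
   Invariance is the equality with the image, since closedness together with
   inclusion of the image alone would allow non-invertible systems. *)
Record subshift (A : finType) := Subshift {
  carrier :> set (full_shift A);
  carrier_nonempty : carrier !=set0;
  carrier_closed : closed carrier;
  carrier_shift : shift_by 1 @` carrier = carrier }.

Definition points (A : finType) (X : subshift A) : Type := set_type (carrier X).

HB.instance Definition _ (A : finType) (X : subshift A) :=
  Topological.copy (points X) (set_type (carrier X)).

Lemma points_inhabited (A : finType) (X : subshift A) : exists x : points X, True.
Proof.
by have [x Sx] := carrier_nonempty X; exists (exist _ x (mem_set Sx)).
Qed.

HB.instance Definition _ (A : finType) (X : subshift A) :=
  isPointed.Build (points X) (projT1 (cid (points_inhabited X))).

Definition seq_of (A : finType) (X : subshift A) (x : points X) : full_shift A :=
  set_val x.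

Lemma sigma_subproof (A : finType) (X : subshift A) (x : points X) :
  shift_by 1 (seq_of x) \in carrier X.
Proof.
by apply/mem_set; rewrite -(carrier_shift X); exists (seq_of x) => //; exact: set_valP.
Qed.

Definition sigma (A : finType) (X : subshift A) (x : points X) : points X :=
  exist _ (shift_by 1 (seq_of x)) (sigma_subproof x).

Definition shift_orbit (A : finType) (X : subshift A) (x : points X) : set (points X) :=
  [set y | exists l : int, seq_of y = shift_by l (seq_of x)].

Definition minimal (A : finType) (X : subshift A) : Prop :=
  forall x : points X, dense (shift_orbit x).

Definition factor_map (A B : finType) (Y : subshift B) (X : subshift A)
    (pi : points Y -> points X) : Prop :=
  [/\ continuous pi, range pi = [set: points X]
    & forall y, pi (sigma y) = sigma (pi y)].

Definition almost_one_to_one (A B : finType) (Y : subshift B) (X : subshift A)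
    (pi : points Y -> points X) : Prop :=
  exists x : points X, pi @^-1` [set x] #= `I_1.

Definition borel (A : finType) (X : subshift A) :=
  g_sigma_algebraType (@open (points X)).

Definition invariant_measures (R : realType) (A : finType) (X : subshift A) :
    set (probability (borel X) R) :=
  [set mu | forall E : set (borel X), measurable E -> mu (@sigma A X @` E) = mu E].

Arguments invariant_measures R {A} X.

Section visits.
Context (R : realType) (A : finType) (X : subshift A) (D : set (points X)).

Definition frequency (n : nat) (x : points X) : R :=
  n%:R^-1 * \sum_(i < n) \1_D (iter i (@sigma A X) x).

Definition frequency_limits : set R :=
  \bigcup_x \bigcap_(N in [set N | (1 <= N)%N])
    closure [set frequency n x | n in [set n | (N <= n)%N]].

End visits.

Arguments frequency R {A X} D n x.
Arguments frequency_limits R {A X} D.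

Definition multi_valued (A B : finType) (Y : subshift B) (X : subshift A)
    (pi : points Y -> points X) : set (points X) :=
  [set x | exists y z, [/\ pi y = x, pi z = x & seq_of y 0 <> seq_of z 0]].

(* Main.v *)
Require Import Defs.
From mathcomp Require Import all_boot all_order all_algebra.
From mathcomp Require Import all_classical all_reals all_analysis.
From mathcomp Require Import zify lra.
Import Order.TTheory GRing.Theory Num.Theory.
Import numFieldNormedType.Exports.
Local Open Scope classical_set_scope.
Local Open Scope card_scope.
Local Open Scope ring_scope.

(** Frequencies of visits to [D] turn out to be limited by a gap: every element
of [frequency_limits R D] is [0] or at least [1/2], and both kinds occur
([frequency_limits_dichotomy], [zero_frequency_limit],
[positive_frequency_limit]). A closed interval starting at [0] and containing a
number at least [1/2] contains [1/4], so the set of limits is no such interval,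
whatever the value of its right end; invariant measures need not be examined.

The extension attaches a bit to every position of every point of [X]. The bit
is computed by a continuous rule that is silent at some positions, called
free, and the extension is the closure of the graph of this rule. Fix a point
[x0]. The occurrences in [x] of longer and longer central words of [x0] are
the markers of levels [0, 1, 2, ...]; they cut [x] into blocks, and the blocks
of each level refine those of the next. Around every marker of level [k+1]
there are two unions of blocks of level [k]: a short core, just to the right of
the marker, and a zone, which contains the core and reaches a margin to its left.
The margin is very long compared with the core, and the markers of level [k+1]
are very far apart compared with the margin. A position stops at the first
level at which it lies in a core or lies in a zone for the second time; its
bit is [true] in the first case and [false] in the second. A position that never
stops is free.

The fibres. If one of two positions is free, then from some level on they lie in
the same block ([free_eventually_same]), so from there on the same cores and
zones contain them. In a point near [x] where the free positions of [x] do
stop, one of two things happens first at a high level: a core contains them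
all, and all get the bit [true]; or a zone does, and those that are already in one
zone of [x] get [false], while the others wait for one more zone or core and get
[false] or [true] together. Hence a limit of bits is given by one of at most
three pairs of values ([limit_value_order], [factor_fiber_card]). The two
constant pairs always occur, because a core, and a zone outside its core, is long
enough to contain all words that determine the lower levels
([realize_core], [realize_zone], [completion_limit]). So [D] consists exactly of
the points at which the position [0] is free ([multi_valued_free]).

The gap. It is the reason for the margins and for the two visits to zones.
If all positions in cores stopped, and no others, a position with cores immediately
to its right at infinitely many levels could see low frequencies at these
scales and high frequencies in between. With the rule above such a position
lies in infinitely many zones, hence is not free. A free position is in at
most one zone, and so, apart from finitely many, the positions on its right that
stop do so in a core whose margin it does not meet, or in a zone separated from
it by the distance of two markers ([stopped_classification]). Each of these
is short compared with the interval on its left up to the given free position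
([sparse_visits]), and altogether they have upper density at most [1/4]
([free_density]). A point without free positions never visits [D], and [x0] is
such a point since [0] is a marker of all its levels. *)

Set Implicit Arguments.
Unset Strict Implicit.
Unset Printing Implicit Defensive.

(** * Agreement on windows and the product topology *)

Definition agree (A : Type) (N : nat) (x y : int -> A) : Prop :=
  forall i : int, (absz i <= N)%N -> x i = y i.

Section agreement.
Context {A : Type}.
Implicit Types (x y z : int -> A) (N : nat).

Lemma agree_sym N x y : agree N x y -> agree N y x.
Proof. by move=> h i hi; rewrite h. Qed.

Lemma agree_trans N x y z : agree N x y -> agree N y z -> agree N x z.
Proof. by move=> h1 h2 i hi; rewrite h1// h2. Qed.

Lemma agree_le M N x y : (M <= N)%N -> agree N x y -> agree M x y.
Proof. by move=> MN h i hi; apply: h; apply: leq_trans hi MN. Qed.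

Lemma agree_all x y : (forall N, agree N x y) -> x = y.
Proof. by move=> h; apply/funext => i; apply: (h (absz i)). Qed.

End agreement.

Section shift_space.
Context {A : finType}.
Implicit Types (x y : full_shift A) (U : set (full_shift A)).

Lemma agree_shift M N (l : int) x y : (M + absz l <= N)%N -> agree N x y ->
  agree M (shift_by l x) (shift_by l y).
Proof. by move=> MN h i hi; apply: h; lia. Qed.

Lemma shift_byD (l m : int) x : shift_by l (shift_by m x) = shift_by (l + m) x.
Proof. by apply/funext => i; rewrite /shift_by addrA. Qed.

Lemma shift_by0 x : shift_by 0 x = x.
Proof. by apply/funext => i; rewrite /shift_by addr0. Qed.

Lemma coord_nbhs x (i : int) : nbhs x [set y : full_shift A | x i = y i].
Proof.
have -> : [set y : full_shift A | x i = y i] =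
    @proj int (fun=> discrete_topology A) i @^-1` [set x i].
  by apply/seteqP; split => y /=.
exact: (@proj_continuous int (fun=> discrete_topology A) i x _ (discrete_set1 _)).
Qed.

Lemma nbhs_agreeP x U :
  nbhs x U <-> exists N, forall y, agree N x y -> U y.
Proof.
split=> [|[N NU]]; last first.
  suff : nbhs x [set y : full_shift A | agree N x y] by apply: filterS.
  elim: N {NU} => [|N IH].
    by apply: filterS (coord_nbhs x 0) => y /= xy i; rewrite leqn0 absz_eq0 => /eqP ->.
  apply: filterS (filterI IH (filterI (coord_nbhs x (Posz N.+1)) (coord_nbhs x (- Posz N.+1)))).
  move=> y [/= h [h1 h2]] i hi.
  have [h0|[->|->]] // : (absz i <= N)%N \/ i = Posz N.+1 \/ i = - Posz N.+1 by lia.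
  exact: h.
pose F := filter_from [set: nat] (fun N => [set y : full_shift A | agree N x y]).
have FF : Filter F.
  apply: filter_from_filter; first by exists 0%N.
  move=> M N _ _; exists (maxn M N) => // y h; split; apply: agree_le h.
    exact: leq_maxl.
  exact: leq_maxr.
have Fx : F --> x.
  apply/cvg_sup => i V [B] [[C oC <-] Cx CV].
  by exists (absz i) => // y xy; apply: CV; rewrite /= -xy.
by move=> /Fx [N _ NU]; exists N => y /NU.
Qed.

Lemma closed_agreeP U :
  closed U <-> forall x, (forall N, exists2 y, U y & agree N x y) -> U x.
Proof.
split=> [cU x hx|hU x clx].
  apply: cU => B /nbhs_agreeP [N NB]; have [y Uy xy] := hx N.
  by exists y; split => //; exact: NB.
apply: hU => N.
have [|y [Uy xy]] := clx [set y | agree N x y]; first by apply/nbhs_agreeP; exists N.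
by exists y.
Qed.

Lemma full_shift_compact : compact [set: full_shift A].
Proof.
have cA (i : int) : compact [set: discrete_topology A].
  exact/finite_compact/(@finite_finset A setT).
have /= := tychonoff cA.
by congr compact; apply/seteqP; split.
Qed.

(** Compactness of the full shift, in the form that replaces diagonal arguments. *)
Lemma decreasing_cluster (P : nat -> set (full_shift A)) :
  (forall n, P n !=set0) -> (forall m n, (m <= n)%N -> P n `<=` P m) ->
  exists x, forall n N, exists2 y, P n y & agree N x y.
Proof.
move=> P0 Pdec.
have FF : ProperFilter (filter_from [set: nat] P).
  apply: filter_from_proper; last by move=> n _; exact: P0.
  apply: filter_from_filter; first by exists 0%N.
  move=> m n _ _; exists (maxn m n) => // y Py; split; apply: Pdec Py.
    exact: leq_maxl.
  exact: leq_maxr.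
have [|x [_ clx]] := full_shift_compact FF; first exact: filterT.
exists x => n N.
have [||y [Py xy]] := clx (P n) [set y | agree N x y].
- by exists n.
- by apply/nbhs_agreeP; exists N.
by exists y.
Qed.

End shift_space.

Section subshift_points.
Context {A : finType} (X : subshift A).
Implicit Types (x y : points X) (U : set (points X)).

Lemma seq_ofP x : carrier X (seq_of x).
Proof. exact: set_valP. Qed.

Lemma seq_of_inj x y : seq_of x = seq_of y -> x = y.
Proof. exact: val_inj. Qed.

Lemma seq_ofE (z : full_shift A) : carrier X z -> {x : points X | seq_of x = z}.
Proof. by move=> Xz; exists (exist _ z (mem_set Xz)). Qed.

Lemma seq_of_sigma x : seq_of (sigma x) = shift_by 1 (seq_of x).
Proof. by []. Qed.

Lemma seq_of_iter n x : seq_of (iter n (@sigma A X) x) = shift_by (Posz n) (seq_of x).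
Proof.
elim: n => [|n IH]; first by rewrite shift_by0.
by rewrite iterS seq_of_sigma IH shift_byD -PoszD add1n.
Qed.

Lemma carrier_shift_by (l : int) (z : full_shift A) :
  carrier X z -> carrier X (shift_by l z).
Proof.
have S1 w : carrier X w -> carrier X (shift_by 1 w).
  by move=> Xw; rewrite -(carrier_shift X); exists w.
have S2 w : carrier X w -> carrier X (shift_by (-1) w).
  rewrite -{1}(carrier_shift X) => -[v Xv <-].
  by rewrite shift_byD addNr shift_by0.
case: l => n; elim: n z => [|n IH] z Xz.
- by rewrite shift_by0.
- by have := S1 _ (IH _ Xz); rewrite shift_byD -PoszD add1n.
- exact: S2.
- have := S2 _ (IH _ Xz); rewrite shift_byD.
  by have -> : -1 + Negz n = Negz n.+1 by lia.
Qed.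

Lemma nbhs_pointsP x U :
  nbhs x U <-> exists N, forall y, agree N (seq_of x) (seq_of y) -> U y.
Proof.
split=> [|[N NU]].
  rewrite nbhsE => -[_ [[B oB <-] Bx] BU].
  have /nbhs_agreeP [N NB] : nbhs (seq_of x) B by apply: open_nbhs_nbhs.
  by exists N => y xy; apply: BU; exact: NB.
have : nbhs x (@seq_of A X @^-1` [set z | agree N (seq_of x) z]).
  apply: (@initial_continuous _ _ (set_val : points X -> full_shift A)).
  by apply/nbhs_agreeP; exists N.
by apply: filterS => y; exact: NU.
Qed.

Lemma carrier_agree (z : full_shift A) :
  (forall N, exists2 y, carrier X y & agree N z y) -> carrier X z.
Proof. exact: ((closed_agreeP (carrier X)).1 (@carrier_closed A X) z). Qed.

Lemma minimal_agreeP : minimal X <->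
  forall (x y : full_shift A) N, carrier X x -> carrier X y ->
    exists l : int, agree N (shift_by l x) y.
Proof.
split=> [mX x y N /seq_ofE [x' <-] /seq_ofE [y' <-]|hX x U [y Uy] oU].
  have : nbhs y' [set z : points X | agree N (seq_of y') (seq_of z)].
    by apply/nbhs_pointsP; exists N.
  rewrite nbhsE => -[U [oU Uy] hU].
  have [|z [Uz [l zl]]] := mX x' U _ oU; first by exists y'.
  by exists l; rewrite -zl; apply: agree_sym; exact: hU.
have /nbhs_pointsP [N NU] : nbhs y U by apply: open_nbhs_nbhs.
have [l xl] := hX _ _ N (seq_ofP x) (seq_ofP y).
have [z zE] := seq_ofE (carrier_shift_by l (seq_ofP x)).
exists z; split; last by exists l.
by apply: NU; rewrite zE; exact: agree_sym.
Qed.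

End subshift_points.

(** * Uniform facts on finitely many indices *)

Lemma eventually_all_lt (P : nat -> nat -> Prop) (n : nat) :
  (forall i, (i < n)%N -> exists K, forall k, (K <= k)%N -> P i k) ->
  exists K, forall k, (K <= k)%N -> forall i, (i < n)%N -> P i k.
Proof.
elim: n => [|n IH] h; first by exists 0%N.
have [|K1 h1] := IH; first by move=> i ni; apply: h; lia.
have [K2 h2] := h n (leqnn _).
exists (maxn K1 K2) => k kK i.
rewrite ltnS leq_eqVlt => /orP[/eqP ->|ni]; first by apply: h2; lia.
by apply: h1 => //; lia.
Qed.

Lemma eventually_all_window (P : int -> nat -> Prop) (N : nat) :
  (forall i, exists K, forall k, (K <= k)%N -> P i k) ->
  exists K, forall k, (K <= k)%N -> forall i, (absz i <= N)%N -> P i k.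
Proof.
move=> h.
have [K1 h1] := @eventually_all_lt (fun i => P (Posz i)) N.+1 (fun i _ => h _).
have [K2 h2] := @eventually_all_lt (fun i => P (- Posz i)) N.+1 (fun i _ => h _).
exists (maxn K1 K2) => k kK i iN.
have [->|->] : i = Posz (absz i) \/ i = - Posz (absz i) by lia.
  by apply: h1; lia.
by apply: h2; lia.
Qed.

(** * Recurrence and aperiodicity of minimal subshifts *)

Section minimal_dynamics.
Context {A : finType} (X : subshift A).
Context (Xmin : minimal X).
Implicit Types x y z : full_shift A.

(** If the bound failed for all [R], two successive limits, first of the words
that are missed and then of the points that miss them, would give a point whose
orbit misses a word of [X]. *)
Lemma uniform_recurrence N : exists R : nat, forall z y (t : int),
  carrier X z -> carrier X y ->
  exists l : int, [/\ t <= l, l < t + Posz R & agree N (shift_by l z) y].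
Proof.
pose miss (n : nat) z y := forall l : int, (absz l <= n)%N -> ~ agree N (shift_by l z) y.
suff [n hn] : exists n, forall z y, carrier X z -> carrier X y -> ~ miss n z y.
  exists (n + n).+1 => z y t Xz Xy.
  have /existsNP[l /not_implyP[ln /contrapT hl]] :=
    hn _ _ (carrier_shift_by (t + Posz n) Xz) Xy.
  exists (l + (t + Posz n)); split; [lia|lia|by rewrite -shift_byD].
apply: contrapT => nh.
have ex n : exists y, carrier X y /\ exists2 z, carrier X z & miss n z y.
  apply: contrapT => nex; apply: nh; exists n => z y Xz Xy mzy.
  by apply: nex; exists y; split => //; exists z.
have miss_le m n z y : (m <= n)%N -> miss n z y -> miss m z y.
  by move=> mn h l lm; apply: h; lia.
have [y hy] := @decreasing_cluster A
  (fun n => [set y | carrier X y /\ exists2 z, carrier X z & miss n z y]) ex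
  (fun m n mn y '(conj Xy (ex_intro2 z Xz h)) =>
     conj Xy (ex_intro2 _ _ z Xz (miss_le _ _ _ _ mn h))).
have Xy : carrier X y.
  apply: carrier_agree => M.
  by have [y' [Xy' _] yy'] := hy 0%N M; exists y'.
have ez n : exists z, carrier X z /\ miss n z y.
  have [y' [Xy' [z Xz h]] yy'] := hy n N; exists z; split => // l ln zy.
  by apply: h ln _; apply: agree_trans zy yy'.
have [z hz] := @decreasing_cluster A
  (fun n => [set z | carrier X z /\ miss n z y]) ez
  (fun m n mn z '(conj Xz h) => conj Xz (miss_le _ _ _ _ mn h)).
have Xz : carrier X z.
  apply: carrier_agree => M.
  by have [z' [Xz' _] zz'] := hz 0%N M; exists z'.
have [l zl] := (minimal_agreeP X).1 Xmin _ _ N Xz Xy.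
have [z' [Xz' h] zz'] := hz (absz l) (N + absz l)%N.
apply: (h l (leqnn _)); apply: agree_trans zl; apply: agree_sym.
exact: agree_shift zz'.
Qed.

Context (Xinf : infinite_set (carrier X)).

(** The orbit of a periodic point is finite, and being dense it would be all of
[X]. *)
Lemma aperiodic x (j : nat) : carrier X x -> (0 < j)%N ->
  shift_by (Posz j) x <> x.
Proof.
move=> Xx j0 per; apply: Xinf.
have perM (q : int) : shift_by (q * Posz j) x = x.
  have perN (m : nat) : shift_by (Posz m * Posz j) x = x.
    elim: m => [|m IH]; first by rewrite mul0r shift_by0.
    by rewrite -addn1 PoszD mulrDl mul1r -shift_byD per.
  case: (lerP 0 q) => [q0|q0]; first by rewrite -(gez0_abs q0).
  rewrite -{1}(perN (absz q)) shift_byD -mulrDl.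
  have -> : q + Posz (absz q) = 0 by lia.
  by rewrite mul0r shift_by0.
apply: (@sub_finite_set _ _ ((fun k => shift_by (Posz k) x) @` `I_j)); last first.
  by apply: finite_image; exact: finite_II.
move=> y Xy /=; apply: contrapT => nk.
have [|N hN] := @eventually_all_lt (fun k N => ~ agree N (shift_by (Posz k) x) y) j.
  move=> k kj; apply: contrapT => nN; apply: nk; exists k => //.
  apply: agree_all => N; apply: contrapT => nagr; apply: nN; exists N => N' NN' h.
  by apply: nagr; apply: agree_le h.
have [l hl] := (minimal_agreeP X).1 Xmin _ _ N Xx Xy.
have jz : Posz j != 0 by lia.
apply: (hN N (leqnn _) (absz (l %% Posz j)%Z)).
  by have := ltz_pmod l (_ : 0 < Posz j); have := modz_ge0 l jz; lia.
rewrite gez0_abs ?modz_ge0//.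
move: hl; rewrite {1}(divz_eq l (Posz j)) addrC -shift_byD.
by rewrite perM.
Qed.

(** Two close occurrences of a central word of [x] in any sequence make this word
itself periodic, which a long word of the aperiodic point [x] is not. *)
Lemma separated_returns x (h : nat) : carrier X x -> exists N, forall z (a b : int),
  agree N (shift_by a z) x -> agree N (shift_by b z) x -> a < b -> a + Posz h <= b.
Proof.
move=> Xx.
have [|N hN] := @eventually_all_lt (fun k N => (0 < k)%N ->
    exists i, (absz i + k <= N)%N /\ x (i + Posz k) <> x i) h.
  move=> k _; case: (posnP k) => [->|k0]; first by exists 0%N.
  have /existsNP[i xi] : ~ forall i, x (i + Posz k) = x i.
    by move=> e; apply: (@aperiodic x k Xx k0); apply/funext => i; exact: e.
  by exists (absz i + k)%N => N Nk _; exists i.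
exists N => z a b za zb ab; rewrite leNgt; apply/negP => ba.
have [||i [iN ne]] := hN N (leqnn _) (absz (b - a)); [lia|lia|].
have [ea eb] := (za (i + Posz (absz (b - a))), zb i).
apply: ne; rewrite -ea -?eb; [|lia|lia].
by rewrite /shift_by; congr z; lia.
Qed.

End minimal_dynamics.

(** * Counting *)

(** The [T] translates to the left of the set [P], by multiples of [w], lie in
[[0, n)] and are pairwise disjoint. *)
Lemma disjoint_shifts_count (P : pred nat) (n T w : nat) :
  (forall i t : nat, (i < n)%N -> P i -> (t < T)%N -> (w * t <= i)%N) ->
  (forall i d : nat, (0 < d < T)%N -> P i -> (i + w * d < n)%N -> ~~ P (i + w * d)%N) ->
  (T * \sum_(i < n) P i <= n)%N.
Proof.
move=> Pge Pdisj.
have -> : (\sum_(i < n) P i = #|{: {i : 'I_n | P i}}|)%N.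
  by rewrite card_sig -sum1_card [RHS]big_mkcond; apply: eq_bigr => i _; rewrite inE; case: (P i).
have fP (u : 'I_T * {i : 'I_n | P i}) : (val (val u.2) - w * u.1 < n)%N.
  by apply: leq_ltn_trans (ltn_ord (val u.2)); exact: leq_subr.
pose f u := Ordinal (fP u).
suff /leq_card : injective f by rewrite card_prod !card_ord.
have half (t t' : 'I_T) (i i' : {i : 'I_n | P i}) : f (t, i) = f (t', i') -> (t < t')%N -> False.
  move=> /(congr1 val) /= e tt'.
  have h1 := Pge _ _ (ltn_ord (val i)) (valP i) (ltn_ord t).
  have h2 := Pge _ _ (ltn_ord (val i')) (valP i') (ltn_ord t').
  have wt : (w * t <= w * t')%N by rewrite leq_mul2l (ltnW tt') orbT.
  have e' : val (val i') = (val (val i) + w * (t' - t))%N.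
    rewrite mulnBr; move: e h1 h2 wt.
    by move: (w * t)%N (w * t')%N => p q /=; lia.
  have := Pdisj (val (val i)) (t' - t)%N; rewrite -e' (valP i) (valP i') => h.
  by have := h _ isT (ltn_ord _); have := ltn_ord t'; lia.
move=> [t i] [t' i'] e; have [tt'|tt'|tt'] := ltngtP t t'; first by case: (half _ _ _ _ e tt').
  by case: (half _ _ _ _ (esym e) tt').
move/val_inj: tt' => tt'; subst t'; congr pair.
move: e => /(congr1 val) /= e; apply/val_inj/val_inj => /=.
have h1 := Pge _ _ (ltn_ord (val i)) (valP i) (ltn_ord t).
have h2 := Pge _ _ (ltn_ord (val i')) (valP i') (ltn_ord t).
by move: e h1 h2; move: (w * t)%N => p /=; lia.
Qed.

(** The bound is that of the series of all [n / 2 ^ (j + 4)], uniform in [m]. *)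
Lemma geometric_sum_bound (a : nat -> nat) (n m : nat) :
  (forall j, 2 ^ (j + 4) * a j <= n)%N -> (8 * \sum_(j < m) a j <= n)%N.
Proof.
move=> ha.
suff h : (2 ^ m * (8 * \sum_(j < m) a j) + n <= 2 ^ m * n)%N.
  rewrite -(leq_pmul2l (m := 2 ^ m)) ?expn_gt0//.
  by apply: leq_trans h; exact: leq_addr.
elim: m => [|m IH]; first by rewrite big_ord0 expn0; lia.
rewrite big_ord_recr /= expnS; have := ha m; rewrite expnD => h.
set s := (\sum_(i < m) a i)%N in IH *; set e := (2 ^ m)%N in IH h *; nia.
Qed.

(** Upper density at most [1/4], with an additive error. *)
Definition sparse (r : int -> bool) : Prop :=
  exists C : nat, forall n : nat, (4 * \sum_(i < n) r (Posz i) <= C + n)%N.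

Lemma sparse_shift (r : int -> bool) (l : int) : sparse r -> sparse (fun i => r (i + l)).
Proof.
have up s : sparse s -> sparse (fun i => s (i + 1)).
  move=> [C hC]; exists C.+1 => n; apply: (@leq_trans (4 * \sum_(i < n.+1) s (Posz i))).
    rewrite leq_mul2l big_ord_recl; apply: leq_trans (leq_addl _ _).
    by apply: leq_sum => i _; rewrite (_ : Posz i + 1 = Posz (lift ord0 i))// lift0; lia.
  by have := hC n.+1; lia.
have down s : sparse s -> sparse (fun i => s (i - 1)).
  move=> [C hC]; exists (C + 4)%N => -[|n]; first by rewrite big_ord0.
  rewrite big_ord_recl.
  have -> : (\sum_(i < n) s (Posz (lift ord0 i) - 1)%R = \sum_(i < n) s (Posz i))%N.
    by apply: eq_bigr => i _; rewrite (_ : Posz (lift ord0 i) - 1 = Posz i)// lift0; lia.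
  by have := hC n; case: (s _); lia.
move=> hr; case: l => l; elim: l => [|l IH].
- by under eq_fun do rewrite addr0.
- move/up: IH; congr sparse; apply/funext => i; congr r; lia.
- by move/down: hr; congr sparse; apply/funext => i; congr r; lia.
- move/down: IH; congr sparse; apply/funext => i; congr r; lia.
Qed.

(** * Markers, blocks, cores and zones *)

(** Length of the left margin of a core of length [g] of level [k]: the factor
[2 ^ (k + 4)] makes the cores of level [k] a proportion at most [2 ^- (k + 4)] of
what lies between them and any position outside the zone. *)
Definition margin (g k : nat) : nat := (2 * g * 2 ^ (k + 4))%N.

(** Least distance of two markers of level [k + 1]; it bounds the proportion of the
parts of zones left of their markers in the same way. *)
Definition separation (g k : nat) : nat := ((margin g k + g) * (2 ^ (k + 4)).+1)%N.

(** The markers of level [k] are the occurrences of the word of radius [rad k]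
around the origin of [x0]. The recurrence bound [gap k] serves words of radius
[3 * rad k], because the words of radius [2 * rad k] determine the cores and zones
of the levels below [k], and they have to be seen from all positions of a window. *)
Record scales (A : finType) (X : subshift A) (x0 : full_shift A) := Scales {
  rad : nat -> nat;
  gap : nat -> nat;
  gap_gt : forall k, (k < gap k)%N;
  gap_recurrence : forall k z y (t : int), carrier X z -> carrier X y ->
    exists l : int, [/\ t <= l, l < t + Posz (gap k) & agree (3 * rad k) (shift_by l z) y];
  rad_separation : forall k z (a b : int),
    agree (rad k.+1) (shift_by a z) x0 -> agree (rad k.+1) (shift_by b z) x0 ->
    a < b -> a + Posz (separation (gap k) k) <= b;
  rad_step : forall k, (rad k + 2 * gap k + margin (gap k) k < rad k.+1)%N }.

Lemma scales_exist (A : finType) (X : subshift A) (x0 : full_shift A) :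
  infinite_set (carrier X) -> minimal X -> carrier X x0 -> inhabited (scales X x0).
Proof.
move=> Xinf Xmin Xx0.
have [rec recP] := choice (uniform_recurrence Xmin).
have [sep sepP] := choice (fun h => separated_returns Xmin Xinf h Xx0).
pose g n k := maxn (rec (3 * n)%N) k.+1.
pose fix rad k := if k is k'.+1 then
  maxn (sep (separation (g (rad k') k') k')) (rad k' + 2 * g (rad k') k' + margin (g (rad k') k') k').+1
  else 0%N.
constructor; apply: (@Scales A X x0 rad (fun k => g (rad k) k)) => [k|k z y t Xz Xy|k z a b za zb ab|k].
- exact: leq_maxr.
- have [l [tl lt zl]] := recP (3 * rad k)%N z y t Xz Xy.
  by exists l; split => //; rewrite /g; lia.
- by apply: (sepP _ z) => //=; [apply: agree_le za|apply: agree_le zb]; exact: leq_maxl.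
- exact: leq_maxr.
Qed.

Section blocks.
Context {A : finType} {X : subshift A} {x0 : full_shift A} (S : scales X x0).
Context (Xx0 : carrier X x0).
Implicit Types (x y z : full_shift A) (i j p : int) (k : nat).

Local Notation gapS k := (Posz (gap S k)).
Local Notation marginS k := (Posz (margin (gap S k) k)).
Local Notation sepS k := (Posz (separation (gap S k) k)).

Lemma margin_ge k : (32 * gap S k <= margin (gap S k) k)%N.
Proof.
rewrite /margin expnD; have := expn_gt0 2 k; set e := (2 ^ k)%N; nia.
Qed.

Lemma separation_ge k :
  (17 * (margin (gap S k) k + gap S k) <= separation (gap S k) k)%N.
Proof.
rewrite /separation expnD; have := expn_gt0 2 k; set e := (2 ^ k)%N; nia.
Qed.

Lemma rad_mono (j k : nat) : (j <= k)%N -> (rad S j <= rad S k)%N.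
Proof.
elim: k => [|k IH]; first by rewrite leqn0 => /eqP ->.
by rewrite leq_eqVlt => /orP[/eqP ->//|/IH]; have := rad_step S k; lia.
Qed.

Lemma rad_ge k : (k <= rad S k)%N.
Proof. by elim: k => // k IH; have := rad_step S k; lia. Qed.

Definition marker k x p : Prop := agree (rad S k) (shift_by p x) x0.

(** Blocks of level [k] run from one marker to the next. Comparing with all markers
encodes them without choosing end points, and gives an equivalence at once. *)
Definition same k x i j : Prop := forall p, marker k x p -> (p <= i) = (p <= j).

(** The position [c] makes this a union of whole blocks of level [k], so that the
positions of a block are not distinguished from level [k] on. *)
Definition near (u k : nat) x i : Prop := exists c a,
  [/\ same k x i c, marker k.+1 x a, a - Posz u <= c & c < a + gapS k].

Definition core k := near 0 k.

Definition zone k := near (margin (gap S k) k) k.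

Lemma marker_shift k (l : int) x p : marker k (shift_by l x) p = marker k x (p + l).
Proof. by rewrite /marker shift_byD. Qed.

Lemma same_shift k (l : int) x i j : same k (shift_by l x) i j <-> same k x (i + l) (j + l).
Proof.
split=> h p hp; last by rewrite marker_shift in hp; have := h _ hp; lia.
by have := h (p - l); rewrite marker_shift subrK => /(_ hp); lia.
Qed.

Lemma near_shift u k (l : int) x i : near u k (shift_by l x) i <-> near u k x (i + l).
Proof.
split=> -[c [a [hs ha h1 h2]]].
  exists (c + l), (a + l); split; [exact/same_shift|by rewrite -marker_shift|lia|lia].
exists (c - l), (a - l); split; [|by rewrite marker_shift subrK|lia|lia].
by apply/same_shift; rewrite subrK.
Qed.

Lemma marker_le (j k : nat) x p : (j <= k)%N -> marker k x p -> marker j x p.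
Proof. by move=> jk; apply: agree_le; exact: rad_mono. Qed.

Lemma same_refl k x i : same k x i i. Proof. by []. Qed.

Lemma same_sym k x i j : same k x i j -> same k x j i.
Proof. by move=> h p /h ->. Qed.

Lemma same_trans k x i j (l : int) : same k x i j -> same k x j l -> same k x i l.
Proof. by move=> h1 h2 p hp; rewrite h1// h2. Qed.

Lemma same_le (j k : nat) x i i' : (j <= k)%N -> same j x i i' -> same k x i i'.
Proof. by move=> jk h p hp; apply: h; apply: marker_le hp. Qed.

Lemma same_between k x i j (l : int) : i <= j -> j <= l -> same k x i l -> same k x i j.
Proof. by move=> ij jl h p /h; lia. Qed.

Lemma near_same u k x i j : same k x i j -> near u k x i -> near u k x j.
Proof.
move=> ij [c [a [ic ha h1 h2]]]; exists c, a; split=> //.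
by apply: same_trans ic; exact: same_sym.
Qed.

Lemma core_zone k x i : core k x i -> zone k x i.
Proof. by move=> [c [a [ic ha h1 h2]]]; exists c, a; split=> //; lia. Qed.

Lemma marker_sep k x (a b : int) :
  marker k.+1 x a -> marker k.+1 x b -> a < b -> a + sepS k <= b.
Proof. exact: rad_separation. Qed.

Lemma marker_gap k x (t : int) : carrier X x ->
  exists p, [/\ t <= p, p < t + gapS k & marker k x p].
Proof.
move=> Xx; have [p [tp pt h]] := gap_recurrence S k t Xx Xx0.
by exists p; split => //; apply: agree_le h; lia.
Qed.

Lemma same_lt k x i j : carrier X x -> same k x i j -> i < j + gapS k.
Proof.
move=> Xx h; rewrite ltNge; apply/negP => ji.
have [p [tp pt /h]] := marker_gap k (j + 1) Xx.
by lia.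
Qed.

Lemma same_local k x y i j (N : nat) : agree N x y -> (absz i + rad S k <= N)%N ->
  (absz j + rad S k <= N)%N -> same k x i j -> same k y i j.
Proof.
move=> xy iN jN h p hp.
have [pN|pN] := leqP (absz p + rad S k) N; last by lia.
apply: h; apply: agree_trans hp; apply: agree_shift xy; lia.
Qed.

(** A block, and the markers of the next level that are close to it, are seen in a
window of radius [2 * rad S k.+1]. *)
Lemma near_local u k x y i (N : nat) : carrier X x -> carrier X y -> agree N x y ->
  (u <= margin (gap S k) k)%N -> (2 * rad S k.+1 + absz i <= N)%N ->
  near u k x i <-> near u k y i.
Proof.
move=> Xx Xy xy um iN.
suff imp z w : carrier X z -> agree N z w -> near u k z i -> near u k w i.
  by split; apply: imp => //; exact: agree_sym.
move=> {x y Xx Xy xy} Xz zw [c [a [hs ha h1 h2]]]; exists c, a.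
have st := rad_step S k.
have c1 := same_lt Xz hs; have c2 := same_lt Xz (same_sym hs).
split => //; first by apply: same_local hs; [exact: zw|lia|lia].
by apply: agree_trans ha; apply: agree_sym; apply: agree_shift zw; lia.
Qed.

(** The next three lemmas realize an arbitrary word of [X] at chosen places in [x0]
close to its marker [0]: just after it, just before it, and beyond its zone. *)

Lemma x0_marker k : marker k x0 0.
Proof. by rewrite /marker shift_by0. Qed.

Lemma realize_core x k : carrier X x ->
  exists y, [/\ carrier X y, agree (3 * rad S k) x y & core k y 0].
Proof.
move=> Xx; have [l [l0 l1 h]] := gap_recurrence S k 0 Xx0 Xx.
exists (shift_by l x0); split; [exact: carrier_shift_by|exact: agree_sym|].
apply/near_shift; exists (0 + l), 0; split; [exact: same_refl|exact: x0_marker|lia|lia].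
Qed.

Lemma realize_zone x k : carrier X x ->
  exists y, [/\ carrier X y, agree (3 * rad S k) x y, zone k y 0 & ~ core k y 0].
Proof.
move=> Xx; have [l [l0 l1 h]] := gap_recurrence S k (- gapS k) Xx0 Xx.
exists (shift_by l x0); split; [exact: carrier_shift_by|exact: agree_sym| |].
  have mg := margin_ge k.
  apply/near_shift; exists (0 + l), 0; split; [exact: same_refl|exact: x0_marker|lia|lia].
move=> /near_shift [c [a [hs ha ac ca]]].
have al := hs a (marker_le (leqnSn k) ha).
have := marker_sep ha (@x0_marker k.+1); have := same_lt Xx0 hs.
have := separation_ge k; have := margin_ge k; lia.
Qed.

Lemma realize_outside x k : carrier X x ->
  exists y, [/\ carrier X y, agree (3 * rad S k) x y & ~ zone k y 0].
Proof.
move=> Xx; have [l [l0 l1 h]] := gap_recurrence S k (2 * gapS k) Xx0 Xx.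
exists (shift_by l x0); split; [exact: carrier_shift_by|exact: agree_sym|].
move=> /near_shift [c [a [hs ha ac ca]]].
have c1 := same_lt Xx0 hs; have c2 := same_lt Xx0 (same_sym hs).
have := separation_ge k; have := margin_ge k.
have [a0|a0] := lerP a 0; first by lia.
by have := marker_sep (@x0_marker k.+1) ha a0; lia.
Qed.

(** * Stopping positions and free positions *)

Definition stop k x i : Prop :=
  core k x i \/ (zone k x i /\ exists2 j : nat, (j < k)%N & zone j x i).

Definition free x i : Prop := forall k, ~ stop k x i.

Definition decided x i (b : bool) : Prop :=
  exists k, [/\ stop k x i, forall j : nat, (j < k)%N -> ~ stop j x i & b <-> core k x i].

Lemma core_shift k (l : int) x i : core k (shift_by l x) i <-> core k x (i + l).
Proof. exact: near_shift. Qed.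

Lemma zone_shift k (l : int) x i : zone k (shift_by l x) i <-> zone k x (i + l).
Proof. exact: near_shift. Qed.

Lemma stop_shift k (l : int) x i : stop k (shift_by l x) i <-> stop k x (i + l).
Proof.
by rewrite /stop core_shift zone_shift; split=> -[c|[z [j jk zj]]];
  [left|right; split=> //; exists j => //; apply/zone_shift|
   left|right; split=> //; exists j => //; apply/zone_shift].
Qed.

Lemma free_shift (l : int) x i : free (shift_by l x) i <-> free x (i + l).
Proof. by split=> h k sk; apply: (h k); apply/(stop_shift k l x i). Qed.

Lemma decided_shift (l : int) x i b :
  decided (shift_by l x) i b <-> decided x (i + l) b.
Proof.
have st k := stop_shift k l x i; have co k := core_shift k l x i.
split=> -[k [s m c]]; exists k; split.
- exact/st.
- by move=> j jk /st; exact: m.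
- by rewrite c.
- exact/st.
- by move=> j jk /st; exact: m.
- by rewrite c co.
Qed.

Lemma core_local k x y i (N : nat) : carrier X x -> carrier X y -> agree N x y ->
  (2 * rad S k.+1 + absz i <= N)%N -> core k x i <-> core k y i.
Proof. by move=> Xx Xy xy; exact: near_local. Qed.

Lemma zone_local k x y i (N : nat) : carrier X x -> carrier X y -> agree N x y ->
  (2 * rad S k.+1 + absz i <= N)%N -> zone k x i <-> zone k y i.
Proof. by move=> Xx Xy xy; exact: near_local. Qed.

Lemma stop_local k x y i (N : nat) : carrier X x -> carrier X y -> agree N x y ->
  (2 * rad S k.+1 + absz i <= N)%N -> stop k x i <-> stop k y i.
Proof.
move=> Xx Xy xy kN; rewrite /stop (core_local Xx Xy xy kN) (zone_local Xx Xy xy kN).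
have zl (j : nat) : (j < k)%N -> zone j x i <-> zone j y i.
  move=> jk; apply: (zone_local Xx Xy xy).
  by have := rad_mono (ltnW jk : (j.+1 <= k.+1)%N); lia.
by split=> -[?|[? [j jk hj]]]; [left|right; split=> //; exists j => //; apply/zl|
  left|right; split=> //; exists j => //; apply/zl].
Qed.

Lemma decided_inj x i b c : decided x i b -> decided x i c -> b = c.
Proof.
move=> [k [sk mk hb]] [l [sl ml hc]].
have kl : k = l.
  by case: (ltngtP k l) => // [/ml|/mk].
by move: hc; rewrite -kl -hb => h; apply/idP/idP => /h.
Qed.

Lemma not_free_decided x i : ~ free x i -> exists b, decided x i b.
Proof.
move=> /existsNP[k /contrapT sk].
have ex : exists k, `[< stop k x i >] by exists k; apply/asboolP.
exists `[< core (ex_minn ex) x i >].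
case: ex_minnP => m /asboolP sm mmin; exists m; split=> //.
  by move=> j jm sj; have := mmin j (asboolT sj); lia.
by split=> [/asboolP|h]; [|apply/asboolP].
Qed.

Lemma decided_at_local k x y i (b : bool) (N : nat) : carrier X x -> carrier X y -> agree N x y ->
  (2 * rad S k.+1 + absz i <= N)%N ->
  [/\ stop k x i, forall j : nat, (j < k)%N -> ~ stop j x i & b <-> core k x i] ->
  decided y i b.
Proof.
move=> Xx Xy xy kN [sk mk hb]; exists k; split.
- exact/(stop_local Xx Xy xy kN).
- move=> j jk sj; apply: (mk j jk); apply/(stop_local Xx Xy xy) => //.
  by have := rad_mono (ltnW jk : (j.+1 <= k.+1)%N); lia.
- by rewrite hb (core_local Xx Xy xy kN).
Qed.

Lemma decided_local x i b : carrier X x -> decided x i b ->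
  exists K, forall N y, (K <= N)%N -> carrier X y -> agree N x y -> decided y i b.
Proof.
move=> Xx [k hk]; exists (2 * rad S k.+1 + absz i)%N => N y KN Xy xy.
exact: decided_at_local xy KN hk.
Qed.

(** A free position lies in at most one zone. *)
Lemma free_eventually_outside x i : free x i ->
  exists K, forall k, (K <= k)%N -> ~ zone k x i.
Proof.
move=> fr; have [[j zj]|nz] := pselect (exists k, zone k x i).
  by exists j.+1 => k jk zk; apply: (fr k); right; split=> //; exists j.
by exists 0%N => k _ zk; apply: nz; exists k.
Qed.

Lemma zone_near_marker k x i p : marker k.+1 x p ->
  p - marginS k <= i -> i < p + gapS k -> zone k x i.
Proof. by move=> hp h1 h2; exists i, p; split. Qed.

(** If [i] and [j] were separated by markers of arbitrarily high level, then these
markers would have [i] in their zones. *)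
Lemma free_eventually_same x i j : free x i ->
  exists K, forall k, (K <= k)%N -> same k x i j.
Proof.
move=> /free_eventually_outside [K hK].
exists (maxn K.+1 (absz (i - j)).+1) => k kK p hp.
apply: contrapT => pij; case: k hp kK => [|k] hp kK; first by lia.
have gk := gap_gt S k; have mk := margin_ge k.
apply: (hK k); first by lia.
by apply: (zone_near_marker hp); lia.
Qed.

(** The origin of [x0] is a marker of every level. *)
Lemma x0_not_free i : ~ free x0 i.
Proof.
move=> /free_eventually_outside [K hK].
have := gap_gt S (maxn K (absz i)); have := margin_ge (maxn K (absz i)).
move=> mk gk; apply: (hK (maxn K (absz i))); first by exact: leq_maxl.
by apply: (zone_near_marker (@x0_marker _)); lia.
Qed.

(** The graph of the rule on a window is required of a point [y] near [x], because
the rule itself is silent at the free positions of [x]; these are the points of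
the closure of the graph. *)
Definition limit_value x (g : int -> bool) : Prop := forall N, exists y,
  [/\ carrier X y, agree N x y & forall i, (absz i <= N)%N -> decided y i (g i)].

Lemma limit_value_carrier x g : limit_value x g -> carrier X x.
Proof. by move=> h; apply: carrier_agree => N; have [y [Xy xy _]] := h N; exists y. Qed.

Lemma limit_value_decided x g i b : limit_value x g -> decided x i b -> g i = b.
Proof.
move=> lim dx; have Xx := limit_value_carrier lim.
have [K hK] := decided_local Xx dx.
have [y [Xy xy dy]] := lim (maxn K (absz i)).
apply: (decided_inj (dy i (leq_maxr _ _))).
exact: hK (leq_maxl _ _) Xy xy.
Qed.

(** Zones of [x] met by free positions have low level, and at higher levels [i] and
[j] are in the same cores and zones. If [i] gets [true], it does so in a core,
which contains [j] too; and [j] has not stopped earlier, since it would have met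
its second zone, which would be the second one for [i] as well. *)
Lemma limit_value_order x g i j : limit_value x g -> free x i -> free x j ->
  ((exists k, zone k x i) \/ ~ (exists k, zone k x j)) -> g i -> g j.
Proof.
move=> lim fi fj hij gi; have Xx := limit_value_carrier lim.
have [Ki hKi] := free_eventually_outside fi.
have [Kj hKj] := free_eventually_outside fj.
have [Ks hKs] := free_eventually_same j fi.
pose K := (Ki + Kj + Ks)%N.
pose N := (2 * rad S K.+1 + absz i + absz j)%N.
have [y [Xy xy dy]] := lim N.
have radK k : (k < K)%N -> (rad S k.+1 <= rad S K.+1)%N by move=> kK; apply: rad_mono; lia.
have sameK k : (K <= k)%N -> same k y i j.
  move=> Kk; apply: (same_le Kk); have := rad_mono (leqnSn K) => rK.
  by apply: (same_local xy) => //; [rewrite /N; lia|rewrite /N; lia|apply: hKs; rewrite /K; lia].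
have lowi k : (k < K)%N -> zone k y i <-> zone k x i.
  by move=> kK; symmetry; apply: (zone_local Xx Xy xy); have := radK _ kK; rewrite /N; lia.
have lowj k : (k < K)%N -> zone k y j <-> zone k x j.
  by move=> kK; symmetry; apply: (zone_local Xx Xy xy); have := radK _ kK; rewrite /N; lia.
have nostopi k : (k < K)%N -> ~ stop k y i.
  move=> kK s; apply: (fi k); apply/(stop_local Xx Xy xy) => //.
  by have := radK _ kK; rewrite /N; lia.
have nostopj k : (k < K)%N -> ~ stop k y j.
  move=> kK s; apply: (fj k); apply/(stop_local Xx Xy xy) => //.
  by have := radK _ kK; rewrite /N; lia.
have [|k [sk mk ck]] := dy i; first by rewrite /N; lia.
have [|l [sl ml cl]] := dy j; first by rewrite /N; lia.
have Kk : (K <= k)%N by rewrite leqNgt; apply/negP => /nostopi.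
have Kl : (K <= l)%N by rewrite leqNgt; apply/negP => /nostopj.
have corei : core k y i by apply/ck.
have corej : core k y j := near_same (sameK _ Kk) corei.
apply/cl; case: (ltngtP l k) => [lk|kl|->//]; last first.
  by case: (ml k kl); left.
exfalso; have sij := same_sym (sameK _ Kl).
apply: (mk l lk); case: sl => [c|[z [m ml' zm]]]; first by left; apply: near_same sij c.
right; split; first exact: near_same sij z.
have [Km|mK] := leqP K m.
  by exists m => //; apply: near_same (same_sym (sameK _ Km)) zm.
have [[n zn]|nz] := hij; last by case: nz; exists m; apply/lowj.
have nK : (n < K)%N.
  by rewrite ltnNge; apply/negP => Kn; apply: (hKi n) => //; move: Kn; rewrite /K; lia.
by exists n; [lia|apply/lowi].
Qed.

Definition value x i : bool := `[< decided x i true >].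

Lemma decided_value x i : ~ free x i -> decided x i (value x i).
Proof.
move=> /not_free_decided [[] d]; rewrite /value; first by rewrite asboolT.
by rewrite asboolF // => /(decided_inj d).
Qed.

(** The values at the free positions when these all get the same bit. *)
Definition completion (v : bool) x i : bool := if `[< free x i >] then v else value x i.

(** For [v = true], the block of level [K] containing the window is placed in a
core. For [v = false], it is placed in a zone of level [K] and outside its core,
and then the block of level [K + 1] likewise, so that the positions which are in no
zone of [x] meet two zones. *)
Lemma completion_limit (v : bool) x : carrier X x -> limit_value x (completion v x).
Proof.
move=> Xx N.
have [[i0 f0]|nf] := pselect (exists i, free x i); last first.
  exists x; split=> // i _; rewrite /completion asboolF; last by move=> f; apply: nf; exists i.
  by apply: decided_value => f; apply: nf; exists i.
have [|K1 hK1] := @eventually_all_window (fun i k => same k x 0 i) N.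
  move=> i; have [a ha] := free_eventually_same 0 f0.
  have [b hb] := free_eventually_same i f0.
  exists (maxn a b) => k abk; apply: (same_trans (same_sym _)); [apply: ha|apply: hb]; lia.
have [|K2 hK2] := @eventually_all_window (fun i k => ~ free x i -> exists2 j : nat, (j < k)%N &
    [/\ stop j x i, forall j' : nat, (j' < j)%N -> ~ stop j' x i &
      value x i <-> core j x i]) N.
  move=> i; have [fr|/decided_value [j hj]] := pselect (free x i); first by exists 0%N.
  by exists j.+1 => k jk _; exists j.
pose K := maxn N (maxn K1 K2).
have [KN KK1 KK2] : [/\ (N <= K)%N, (K1 <= K)%N & (K2 <= K)%N].
  by rewrite /K; split; lia.
have KR := rad_ge K.
(* Below level [K], a point that agrees with [x] on the radius [3 * rad S K]
   looks like [x] from all positions of the window. *)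
have dec y i : carrier X y -> agree (3 * rad S K) x y -> (absz i <= N)%N ->
    ~ free x i -> decided y i (completion v x i).
  move=> Xy xy iN nfi; rewrite /completion asboolF//.
  have [j jK hj] := hK2 K KK2 i iN nfi.
  by apply: (decided_at_local Xx Xy xy _ hj); have := rad_mono jK; lia.
have low y i k : carrier X y -> agree (3 * rad S K) x y -> (absz i <= N)%N -> (k < K)%N ->
    stop k x i <-> stop k y i.
  by move=> Xy xy iN kK; apply: (stop_local Xx Xy xy); have := rad_mono kK; lia.
have sameK y i k : agree (3 * rad S K) x y -> (absz i <= N)%N -> (K <= k)%N -> same k y 0 i.
  move=> xy iN Kk; apply: (same_le Kk); apply: (same_local xy) => //; [lia|lia|].
  exact: hK1.
case: v dec => dec.
  have [y [Xy xy cy]] := realize_core K Xx.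
  exists y; split=> //; first by apply: agree_le xy; lia.
  move=> i iN; have [fi|nfi] := pselect (free x i); last exact: dec.
  have ci : core K y i by apply: near_same cy; exact: sameK.
  rewrite /completion asboolT//; exists K; split=> //; first by left.
  by move=> j jK /(low _ _ _ Xy xy iN jK); exact: fi.
have [y [Xy xy zy ncy]] := realize_zone K Xx.
have [w [Xw yw zw ncw]] := realize_zone K.+1 Xy.
have RK := rad_step S K.
have xw : agree (3 * rad S K) x w by apply: agree_trans xy _; apply: agree_le yw; lia.
exists w; split=> //; first by apply: agree_le xw; lia.
move=> i iN; have [fi|nfi] := pselect (free x i); last exact: dec.
have si := sameK _ _ K xw iN (leqnn _).
have siS := sameK _ _ K.+1 xw iN (leqnSn _).
have zK : zone K w i.
  by apply: near_same si _; apply/(zone_local Xy Xw yw); [lia|exact: zy].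
have ncK : ~ core K w i.
  move=> c; apply: ncy; apply/(core_local Xy Xw yw); first by lia.
  exact: near_same (same_sym si) c.
have zS : zone K.+1 w i := near_same siS zw.
have ncS : ~ core K.+1 w i by move=> c; apply: ncw; exact: near_same (same_sym siS) c.
rewrite /completion asboolT//.
have [sK|nsK] := pselect (stop K w i).
  exists K; split=> //.
  by move=> j jK /(low _ _ _ Xw xw iN jK); exact: fi.
exists K.+1; split=> //; first by right; split=> //; exists K.
move=> j; rewrite ltnS leq_eqVlt => /orP[/eqP ->//|jK].
by move=> /(low _ _ _ Xw xw iN jK); exact: fi.
Qed.

(** * Density of the free positions *)

(** The position [i] is in the interval of length [w] starting at [a + u], where [a]
is a marker of level [j + 1], and this interval can be translated [2 ^ (j + 4)] times
by [w] to the left, counting the trivial translation, without leaving the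
nonnegative positions. *)
Definition visit (j w : nat) (u : int) x (i : nat) : Prop := exists a,
  [/\ marker j.+1 x a, a + u <= Posz i, Posz i < a + u + Posz w &
      Posz (w * 2 ^ (j + 4)) <= a + u + Posz w].

Lemma sparse_visits (j w : nat) (u : int) x (n : nat) :
  (w * 2 ^ (j + 4) <= separation (gap S j) j)%N ->
  (2 ^ (j + 4) * \sum_(i < n) `[< visit j w u x i >] <= n)%N.
Proof.
move=> wsep; set T := (2 ^ (j + 4))%N in wsep *.
apply: (@disjoint_shifts_count (fun i : nat => `[< visit j w u x i >]) n T w).
  move=> i t _ /asboolP [a [_ h1 h2 h3]] tT.
  rewrite -/T in h3.
  have : (w * t.+1 <= w * T)%N by rewrite leq_mul2l tT orbT.
  by rewrite mulnS; lia.
move=> i d /andP[d0 dT] /asboolP [a [ma h1 h2 h3]] _.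
apply/negP => /asboolP [b [mb k1 k2 k3]]; rewrite -/T in h3 k3.
have wd1 : (w * d.+1 <= w * T)%N by rewrite leq_mul2l dT orbT.
have wd2 : (w * 1 <= w * d)%N by rewrite leq_mul2l d0 orbT.
rewrite mulnS in wd1; rewrite muln1 in wd2.
have [ab|ba|ab] := ltgtP a b.
- by have := marker_sep ma mb ab; lia.
- by have := marker_sep mb ma ba; lia.
- by subst b; lia.
Qed.

Definition core_stop (j : nat) := visit j (2 * gap S j) 0.

Definition zone_stop (j : nat) :=
  let w := (margin (gap S j) j + gap S j)%N in visit j w (- Posz w).

(** A core whose margin contains [0] has [0] in its zone, and this happens at
finitely many levels. When [i] is in a zone of level [j] and in one of level
[k > j], either [0] and [i] share a block of level [j + 1], so that [0] is in the zone
of level [k] too, or a marker of level [j + 1] lies between them, at a distance of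
at least [separation] from the marker whose zone contains [i]. *)
Lemma stopped_classification x : carrier X x -> free x 0 ->
  exists C, forall i : nat, (C <= i)%N -> ~ free x (Posz i) ->
    exists j : nat, core_stop j x i \/ zone_stop j x i.
Proof.
move=> Xx f0; have [K hK] := free_eventually_outside f0.
pose C := (\max_(k < K.+1) (margin (gap S k) k + 2 * gap S k))%N.
have zK k : zone k x 0 -> (k < K)%N.
  by move=> z0; rewrite ltnNge; apply/negP => /hK.
have Cge k : (k <= K)%N -> (margin (gap S k) k + 2 * gap S k <= C)%N.
  by rewrite -ltnS => kK; exact: (leq_bigmax (Ordinal kK)).
have coreA (j i : nat) : (C <= i)%N -> core j x (Posz i) -> exists j : nat, core_stop j x i \/ zone_stop j x i.
  move=> Ci ci; have [c [a [hs ha ac ca]]] := ci.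
  have ai := hs a (marker_le (leqnSn j) ha).
  have := same_lt Xx hs => ic.
  have [aw|aw] := lerP (Posz (2 * gap S j * 2 ^ (j + 4))) (a + 0 + Posz (2 * gap S j)).
    by exists j; left; exists a; split=> //; lia.
  suff /zK/ltnW/Cge : zone j x 0 by move: aw; rewrite /margin; lia.
  have [c0|c0] := lerP 0 c.
    by apply: (zone_near_marker ha); move: aw; rewrite /margin; lia.
  have i0 : 0 <= Posz i by [].
  have c0' := same_between (ltW c0) i0 (same_sym hs).
  exact/core_zone/(near_same (same_trans hs c0') ci).
exists C => i Ci /existsNP[k /contrapT [ck|[zk [j jk zj]]]]; first exact: coreA ck.
have [c [a [hs ha ac ca]]] := zj.
have ai := hs a (marker_le (leqnSn j) ha).
have ic := same_lt Xx hs; have ci := same_lt Xx (same_sym hs).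
have [ia|ia] := lerP a (Posz i).
  by apply: (coreA j) => //; exists c, a; split=> //; lia.
set w := (margin (gap S j) j + gap S j)%N.
have [aw|aw] := lerP (Posz (w * 2 ^ (j + 4))) (a - Posz w + Posz w).
  by exists j; right; exists a; split => //; rewrite /w; lia.
have s0 : same j.+1 x 0 (Posz i).
  move=> p mp; have [p0|p0] := lerP p 0; first by lia.
  have [pi|//] := lerP p (Posz i).
  have pa : p < a by lia.
  have := marker_sep mp ha pa; move: aw; rewrite subrK /separation -/w mulnS; lia.
have /zK kK : zone k x 0 by apply: near_same zk; apply: same_le (same_sym s0).
have := same_lt Xx (same_sym s0).
by have := Cge j.+1 (leq_trans jk (ltnW kK)); lia.
Qed.

Lemma free_density x : carrier X x -> free x 0 -> exists C, forall n : nat,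
  (4 * \sum_(i < n) `[< ~ free x (Posz i) >] <= C + n)%N.
Proof.
move=> Xx f0; have [C hC] := stopped_classification Xx f0.
exists (4 * C)%N => n.
pose a (j : nat) := (\sum_(i < n) `[< core_stop j x i >])%N.
pose b (j : nat) := (\sum_(i < n) `[< zone_stop j x i >])%N.
have ha (j : nat) : (2 ^ (j + 4) * a j <= n)%N.
  apply: sparse_visits; rewrite /separation /margin.
  by set e := (2 ^ (j + 4))%N; nia.
have hb (j : nat) : (2 ^ (j + 4) * b j <= n)%N.
  by apply: sparse_visits; rewrite /separation leq_mul2l leqnSn orbT.
have low (c : nat -> nat -> Prop) (j : nat) (i : 'I_n) :
    (2 ^ (j + 4) * \sum_(i < n) `[< c j i >] <= n)%N -> c j i -> (j < n)%N.
  move=> h ci; apply: leq_trans h; rewrite (bigD1 i)//= asboolT// mulnDr muln1.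
  apply: leq_trans (leq_addr _ _); apply: leq_trans (ltn_expl _ (ltnSn 1)) _.
  by rewrite leq_exp2l// leq_addr.
have pw (i : 'I_n) : (`[< ~ free x (Posz i) >] <= (i < C) +
    \sum_(j < n) (`[< core_stop j x i >] + `[< zone_stop j x i >]))%N.
  have [nf|//] := asboolP (~ free x (Posz i)).
  have [//|Ci] := ltnP i C.
  have [j cz] := hC i Ci nf.
  have jn : (j < n)%N.
    case: cz => cz.
      exact: (low (fun j : nat => core_stop j x) j i (ha j) cz).
    exact: (low (fun j : nat => zone_stop j x) j i (hb j) cz).
  by rewrite (bigD1 (Ordinal jn))//=; case: cz => cz; rewrite (asboolT cz); lia.
have cC : (\sum_(i < n) (i < C) <= C)%N.
  elim: {ha hb low pw a b} n => [|n IH]; first by rewrite big_ord0.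
  rewrite big_ord_recr /=; have [nC|Cn] := ltnP n C; last by rewrite addn0.
  apply: leq_trans nC; rewrite addn1 ltnS.
  apply: (@leq_trans (\sum_(i < n) 1)); last by rewrite sum1_card card_ord.
  by apply: leq_sum => i _; case: (_ < _)%N.
have tot : (\sum_(i < n) `[< ~ free x (Posz i) >] <= C + (\sum_(j < n) a j + \sum_(j < n) b j))%N.
  apply: leq_trans; first by apply: leq_sum => i _; exact: pw.
  rewrite big_split /= exchange_big /= leq_add// -big_split /=.
  by apply: leq_sum => j _; rewrite big_split.
by have := geometric_sum_bound n ha; have := geometric_sum_bound n hb; lia.
Qed.

(** Diagonal limit of points that leave the zones of one more level at each step. *)
Lemma everywhere_outside_exists : exists x, carrier X x /\ forall k, ~ zone k x 0.
Proof.
pose step k (x y : points X) := agree (3 * rad S k) (seq_of x) (seq_of y) /\ ~ zone k (seq_of y) 0.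
have stepP k (x : points X) : exists y : points X, step k x y.
  have [y [/seq_ofE [y' <-] xy zy]] := realize_outside k (seq_ofP x).
  by exists y'.
have [nxt nxtP] := choice (fun kx : nat * points X => stepP kx.1 kx.2).
pose u := fix u k := if k is k'.+1 then nxt (k', u k') else (proj1_sig (seq_ofE Xx0)).
have uS k : step k (u k) (u k.+1) by exact: nxtP (k, u k).
have uu k m : (k <= m)%N -> agree (3 * rad S k) (seq_of (u k)) (seq_of (u m)).
  elim: m => [|m IH]; first by rewrite leqn0 => /eqP ->.
  rewrite leq_eqVlt => /orP[/eqP ->//|km].
  apply: agree_trans (IH km) _; apply: agree_le (uS m).1.
  by have := rad_mono (km : (k <= m)%N); lia.
pose x : full_shift A := fun i => seq_of (u (absz i)) i.
have ux k : agree k (seq_of (u k)) x.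
  move=> i ik; rewrite /x; symmetry; apply: (uu _ _ ik).
  by have := rad_ge (absz i); lia.
have Xx : carrier X x.
  by apply: carrier_agree => N; exists (seq_of (u N)); [exact: seq_ofP|exact: agree_sym].
exists x; split=> // k zk; apply: (uS k).2.
pose N := (2 * rad S k.+1)%N.
have xu : agree N x (seq_of (u k.+1)).
  have [kN|Nk] := leqP k.+1 N; last by apply: agree_sym; apply: agree_le (ux _); lia.
  apply: agree_trans (agree_sym (ux N)) _; apply: agree_sym.
  by apply: agree_le (uu _ _ kN); rewrite /N; lia.
by apply/(zone_local Xx (seq_ofP _) xu) => //; rewrite /N; lia.
Qed.

Lemma outside_free x i : (forall k, ~ zone k x i) -> free x i.
Proof. by move=> h k [/core_zone /h|[/h]]. Qed.

(** * The extension *)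

Let B : finType := (A * bool)%type.

Definition base (y : full_shift B) : full_shift A := fun i => (y i).1.

Definition mark (y : full_shift B) : int -> bool := fun i => (y i).2.

Definition extension_set : set (full_shift B) := [set y | limit_value (base y) (mark y)].

Lemma limit_value_shift (l : int) x (g : int -> bool) : limit_value x g ->
  limit_value (shift_by l x) (fun i => g (i + l)).
Proof.
move=> lim N; have [y [Xy xy dy]] := lim (N + absz l)%N.
exists (shift_by l y); split; first exact: carrier_shift_by.
  exact: agree_shift xy.
by move=> i iN; apply/decided_shift; apply: dy; lia.
Qed.

Lemma extension_nonempty : extension_set !=set0.
Proof.
by exists (fun i => (x0 i, completion true x0 i)); exact: completion_limit.
Qed.

Lemma extension_closed : closed extension_set.
Proof.
apply/closed_agreeP => y hy N; have [y' Yy' yy'] := hy N.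
have [z [Xz xz dz]] := Yy' N.
exists z; split=> //.
  by apply: agree_trans xz => i iN; rewrite /base yy'.
by move=> i iN; rewrite /mark yy'//; exact: dz.
Qed.

Lemma extension_shift : shift_by 1 @` extension_set = extension_set.
Proof.
apply/seteqP; split=> [_ [y Yy <-]|y Yy]; first exact: (limit_value_shift 1 Yy).
exists (shift_by (-1) y); first exact: (limit_value_shift (-1) Yy).
by rewrite shift_byD addrN shift_by0.
Qed.

Definition extension : subshift B :=
  Subshift extension_nonempty extension_closed extension_shift.

Lemma base_carrier (y : points extension) : base (seq_of y) \in carrier X.
Proof. exact/mem_set/(limit_value_carrier (seq_ofP y)). Qed.

Definition factor (y : points extension) : points X := exist _ (base (seq_of y)) (base_carrier y).

Lemma seq_of_factor (y : points extension) : seq_of (factor y) = base (seq_of y).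
Proof. by []. Qed.

Lemma lift_limit (x : points X) (g : int -> bool) : limit_value (seq_of x) g ->
  exists y : points extension, factor y = x /\ mark (seq_of y) = g.
Proof.
move=> lim; have [y yE] := @seq_ofE _ extension (fun i => (seq_of x i, g i)) lim.
by exists y; split; [apply/seq_of_inj; rewrite seq_of_factor yE|rewrite yE].
Qed.

Lemma points_ext_eq (y z : points extension) : factor y = factor z ->
  mark (seq_of y) = mark (seq_of z) -> y = z.
Proof.
move=> /(congr1 (@seq_of A X)); rewrite !seq_of_factor => e1 e2.
apply/seq_of_inj/funext => i.
move: (congr1 (fun f => f i) e1) (congr1 (fun f => f i) e2); rewrite /base /mark.
by case: (seq_of y i) (seq_of z i) => [a b] [c d] /= -> ->.
Qed.

Lemma factor_fiber (y : points extension) (x : points X) : factor y = x ->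
  limit_value (seq_of x) (mark (seq_of y)).
Proof. by move=> <-; exact: (seq_ofP y). Qed.

Context (Xmin : minimal X).

(** A word of the extension is the graph of the rule over a word of some [z], and the
bits involved are determined by a longer word of [z]; wherever this longer word
occurs in the base point of [y1], the rule leaves no choice for the bits of [y1]. *)
Lemma extension_minimal : minimal extension.
Proof.
apply/minimal_agreeP => y1 y2 N Y1 Y2.
have [z [Xz xz dz]] := Y2 N.
have [|K hK] := @eventually_all_window (fun i k => decided z i (mark y2 i) ->
    forall w, carrier X w -> agree k z w -> decided w i (mark y2 i)) N.
  move=> i; have [d|nd] := pselect (decided z i (mark y2 i)); last by exists 0%N.
  by have [K hK] := decided_local Xz d; exists K => k Kk _ w Xw; exact: hK.
pose M := maxn K N.
have [l hl] := (minimal_agreeP X).1 Xmin _ _ M (limit_value_carrier Y1) Xz.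
exists l.
have [w [Xw yw dw]] := Y1 (M + absz l)%N.
have zw : agree M z (shift_by l w).
  by apply: agree_trans (agree_sym hl) _; exact: agree_shift yw.
have marks (i : int) : (absz i <= N)%N -> mark y1 (i + l) = mark y2 i.
  move=> iN; have d1 : decided w (i + l) (mark y1 (i + l)) by apply: dw; rewrite /M; lia.
  apply: (decided_inj d1); apply/decided_shift.
  apply: (hK M (leq_maxl _ _) i iN (dz i iN) _ (carrier_shift_by l Xw) zw).
move=> i iN; have := marks i iN.
have : base y1 (i + l) = base y2 i.
  by rewrite (xz i iN); apply: hl; rewrite /M; lia.
rewrite /base /mark /shift_by.
by case: (y1 (i + l)) (y2 i) => [a b] [c d] /= -> ->.
Qed.

Lemma factor_is_factor_map : factor_map factor.
Proof.
split.
- move=> y U /nbhs_pointsP [N NU]; apply/nbhs_pointsP; exists N => z yz.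
  by apply: NU => i iN; rewrite !seq_of_factor /base yz.
- apply/seteqP; split=> // x _.
  have [y [yx _]] := lift_limit (completion_limit true (seq_ofP x)).
  by exists y.
- by move=> y; apply/seq_of_inj.
Qed.

Lemma multi_valued_free (x : points X) : multi_valued factor x <-> free (seq_of x) 0.
Proof.
split=> [[y [z [yx zx ne]]]|fx].
  apply: contrapT => /not_free_decided [b db]; apply: ne.
  have ly := factor_fiber yx; have lz := factor_fiber zx.
  have := limit_value_decided ly db; rewrite -(limit_value_decided lz db).
  have := congr1 (fun u => seq_of u 0) yx; rewrite -zx !seq_of_factor /base /mark.
  by case: (seq_of y 0) (seq_of z 0) => [a b'] [c d] /= -> ->.
have [y [yx my]] := lift_limit (completion_limit true (seq_ofP x)).
have [z [zx mz]] := lift_limit (completion_limit false (seq_ofP x)).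
exists y, z; split=> // e.
have := congr1 (fun f => f 0) my; have := congr1 (fun f => f 0) mz.
by rewrite /mark e /completion asboolT// => ->.
Qed.

Lemma factor_almost_one_to_one : almost_one_to_one factor.
Proof.
have [x xE] := seq_ofE Xx0; exists x.
have [y [yx my]] := lift_limit (completion_limit true (seq_ofP x)).
have -> : factor @^-1` [set x] = [set y]; last exact: card_set1.
apply/seteqP; split=> [z zx|z ->] //=.
apply: points_ext_eq; first by rewrite yx.
apply/funext => i.
have nfi : ~ free (seq_of x) i by rewrite xE; exact: x0_not_free.
have [b db] := not_free_decided nfi.
by rewrite (limit_value_decided (factor_fiber zx) db) (limit_value_decided (factor_fiber yx) db).
Qed.

(** [T1] and [T0] are the free positions in one zone and in no zone. The bit of a
point of the fibre is constant on each of them, and [true] on [T1] forces [true]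
on [T0]; so the sum of the two constants determines the point. *)
Lemma factor_fiber_card (x : points X) : factor @^-1` [set x] #<= `I_3.
Proof.
pose T1 i := free (seq_of x) i /\ exists k, zone k (seq_of x) i.
pose T0 i := free (seq_of x) i /\ ~ exists k, zone k (seq_of x) i.
pose c (T : int -> Prop) (y : points extension) : bool :=
  `[< exists2 i, T i & mark (seq_of y) i >].
pose code (y : points extension) := (c T1 y + c T0 y)%N.
have cP1 (y : points extension) i : factor y = x -> T1 i -> mark (seq_of y) i = c T1 y.
  move=> yx [fi zi]; apply/idP/asboolP => [m|[j [fj zj] m]]; first by exists i.
  by apply: (limit_value_order (factor_fiber yx) fj fi) => //; left.
have cP0 (y : points extension) i : factor y = x -> T0 i -> mark (seq_of y) i = c T0 y.
  move=> yx [fi zi]; apply/idP/asboolP => [m|[j [fj zj] m]]; first by exists i.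
  by apply: (limit_value_order (factor_fiber yx) fj fi) => //; right.
have cle (y : points extension) : factor y = x -> forall i, T0 i -> c T1 y -> c T0 y.
  move=> yx i ti /asboolP [j [fj zj] m]; rewrite -(cP0 y i yx ti).
  by apply: (limit_value_order (factor_fiber yx) fj ti.1) => //; left.
have sum_inj (a b a' b' : bool) : (a -> b) -> (a' -> b') -> (a + b = a' + b')%N ->
    a = a' /\ b = b'.
  by move=> /implyP + /implyP; move: a b a' b' => [] [] [] [].
have codelt : {homo code : y / (factor @^-1` [set x]) y >-> (`I_3 : set nat) y}.
  by move=> y _; rewrite /code; move: (c T1 y) (c T0 y) => [] [].
have codeinj : {in factor @^-1` [set x] &, injective code}.
  move=> y z /set_mem /= yx /set_mem /= zx e.
  apply: points_ext_eq; first by rewrite yx zx.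
  apply/funext => i.
  have [fi|/not_free_decided [b db]] := pselect (free (seq_of x) i); last first.
    by rewrite (limit_value_decided (factor_fiber yx) db)
      (limit_value_decided (factor_fiber zx) db).
  have [zi|nzi] := pselect (exists k, zone k (seq_of x) i).
    have ti : T1 i by [].
    rewrite (cP1 y i yx ti) (cP1 z i zx ti).
    have [[i0 t0]|n0] := pselect (exists i, T0 i).
      exact: (sum_inj _ _ _ _ (cle y yx i0 t0) (cle z zx i0 t0) e).1.
    have nc (w : points extension) : c T0 w = false by apply/asboolP => -[i0 t0 _]; apply: n0; exists i0.
    by move: e; rewrite /code !nc !addn0; move: (c T1 y) (c T1 z) => [] [].
  have ti : T0 i by [].
  rewrite (cP0 y i yx ti) (cP0 z i zx ti).
  exact: (sum_inj _ _ _ _ (cle y yx i ti) (cle z zx i ti) e).2.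
have [f fE] := Pinj codeinj; rewrite fE in codelt; have [g _] := injPfun codelt.
exact: inj_card_le g.
Qed.

(** * Frequencies *)

(** [free_density] seen from an arbitrary free position: translating the window changes
the number of its stopped positions by a bounded amount. *)
Lemma free_complement_sparse x i : carrier X x -> free x i ->
  sparse (fun j => `[< ~ free x j >]).
Proof.
move=> Xx fi.
have f0 : free (shift_by i x) 0 by apply/free_shift; rewrite add0r.
have sp : sparse (fun j => `[< ~ free (shift_by i x) j >]).
  exact: (free_density (carrier_shift_by i Xx) f0).
have := sparse_shift (- i) sp.
congr sparse; apply/funext => j; apply/asbool_equiv_eq.
by rewrite free_shift subrK.
Qed.

Section frequencies.
Context (R : realType).

Let D := multi_valued factor.

Lemma frequency_factor (n : nat) (x : points X) :
  frequency R D n x = n%:R^-1 * (\sum_(i < n) `[< free (seq_of x) (Posz i) >])%N%:R.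
Proof.
rewrite /frequency natr_sum; congr (_ * _); apply: eq_bigr => i _.
rewrite indicE; congr (_%:R); congr nat_of_bool.
apply/idP/asboolP => [/set_mem/multi_valued_free|h].
  by rewrite seq_of_iter free_shift add0r.
by apply/mem_set/multi_valued_free; rewrite seq_of_iter free_shift add0r.
Qed.

Lemma frequency_ge0 (n : nat) (x : points X) : 0 <= frequency R D n x.
Proof. by rewrite frequency_factor mulr_ge0 ?invr_ge0. Qed.

Lemma frequency_le1 (n : nat) (x : points X) : frequency R D n x <= 1.
Proof.
rewrite frequency_factor; case: n => [|n]; first by rewrite invr0 mul0r.
rewrite ler_pdivrMl ?ltr0n// mulr1 ler_nat.
apply: (@leq_trans (\sum_(i < n.+1) 1)); last by rewrite sum1_card card_ord.
by apply: leq_sum => i _; case: (`[< _ >]).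
Qed.

Lemma frequency_eq0 (n : nat) (x : points X) : (forall i, ~ free (seq_of x) i) ->
  frequency R D n x = 0.
Proof.
move=> nf; rewrite frequency_factor big1 ?mulr0// => i _.
by rewrite asboolF.
Qed.

Lemma frequency_ge_half (x : points X) i : free (seq_of x) i ->
  exists N, forall n : nat, (N <= n)%N -> 2^-1 <= frequency R D n x.
Proof.
move=> fi; have [C hC] := free_complement_sparse (seq_ofP x) fi.
exists C.+1 => n Cn; rewrite frequency_factor.
have sum : (\sum_(i < n) `[< free (seq_of x) (Posz i) >] +
    \sum_(i < n) `[< ~ free (seq_of x) (Posz i) >] = n)%N.
  rewrite -big_split /= -[RHS]card_ord -sum1_card; apply: eq_bigr => j _.
  by rewrite asbool_neg; case: (`[< _ >]).
have key : (n <= 2 * \sum_(i < n) `[< free (seq_of x) (Posz i) >])%N.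
  by have := hC n; lia.
rewrite ler_pdivlMl ?ltr0n//; last by lia.
by move: key; rewrite -(ler_nat R) natrM; lra.
Qed.

Lemma closure_frequencies (F : set R) (N : nat) (x : points X) (r : R) : closed F ->
  (forall n : nat, (N <= n)%N -> F (frequency R D n x)) ->
  closure [set frequency R D n x | n in [set n | (N <= n)%N]] r -> F r.
Proof. by move=> cF hF cl; apply: cF; apply: closure_subset cl => _ [n Nn <-]; exact: hF. Qed.

Lemma frequency_limits_dichotomy (r : R) : frequency_limits R D r -> r = 0 \/ 2^-1 <= r.
Proof.
move=> [x _ lim]; have [[i fi]|nf] := pselect (exists i, free (seq_of x) i).
  right; have [N hN] := frequency_ge_half fi.
  apply: (@closure_frequencies [set s | 2^-1 <= s] N.+1 x) (lim N.+1 isT); first exact: closed_ge.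
  by move=> n Nn; apply: hN; exact: ltnW.
left; apply: (@closure_frequencies [set s | s = 0] 1 x) (lim 1%N isT); first exact: closed_eq.
by move=> n _; apply: frequency_eq0 => i fi; apply: nf; exists i.
Qed.

Lemma zero_frequency_limit : frequency_limits R D 0.
Proof.
have [x xE] := seq_ofE Xx0; exists x => // N _; apply: subset_closure.
by exists N => //=; apply: frequency_eq0 => i; rewrite xE; exact: x0_not_free.
Qed.

(** The frequencies along a point with a free position are at least [1/2] in the
end, and so are their cluster points, which exist by compactness. *)
Lemma positive_frequency_limit : exists2 r, frequency_limits R D r & 2^-1 <= r.
Proof.
have [z [/seq_ofE [x <-] nz]] := everywhere_outside_exists.
have f0 := outside_free nz.
have [|r [_ clr]] := @segment_compact R 0 1 ((fun n => frequency R D n x) @ \oo) _.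
  by exists 0%N => // n _ /=; rewrite in_itv /= frequency_ge0 frequency_le1.
have lim N : closure [set frequency R D n x | n in [set n | (N <= n)%N]] r.
  move=> U rU; apply: clr rU.
  by exists N => // n /= Nn; exists n.
exists r; first by exists x => // N _; exact: lim.
have [N hN] := frequency_ge_half f0.
by apply: (@closure_frequencies [set s | 2^-1 <= s] N x) (lim N) => //; exact: closed_ge.
Qed.

Lemma frequency_limits_not_interval (s : \bar R) :
  frequency_limits R D <> [set r : R | (0 <= r%:E)%E /\ (r%:E <= s)%E].
Proof.
have [r limr r2] := positive_frequency_limit.
move=> E; have [_ rs] : (0 <= r%:E)%E /\ (r%:E <= s)%E by rewrite E in limr.
have : frequency_limits R D 4^-1.
  rewrite E; split; first by rewrite lee_fin; lra.
  by apply: le_trans rs; rewrite lee_fin; lra.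
by move=> /frequency_limits_dichotomy [|]; lra.
Qed.

End frequencies.

End blocks.

Unset Implicit Arguments.

Theorem theorem2 (R : realType) (A : finType) (X : subshift A) :
  infinite_set (carrier X) -> minimal X ->
  exists (B : finType) (Y : subshift B) (pi : points Y -> points X),
    [/\ minimal Y,
        factor_map pi,
        almost_one_to_one pi,
        forall x : points X, pi @^-1` [set x] #<= `I_3
      & let D := multi_valued pi in
        [set 0] `<` frequency_limits R D /\
        frequency_limits R D <>
          [set r : R | (0 <= r%:E)%E /\
            (r%:E <= ereal_sup [set mu D | mu in invariant_measures R X])%E]].
Proof.
move=> Xinf Xmin; have [x0 Xx0] := carrier_nonempty X.
have [S] := scales_exist Xinf Xmin Xx0.
exists (A * bool)%type, (extension S Xx0), (@factor A X x0 S Xx0); split.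
- exact: extension_minimal.
- exact: factor_is_factor_map.
- exact: factor_almost_one_to_one.
- exact: factor_fiber_card.
split; last exact: frequency_limits_not_interval.
split=> [_ ->|sub0]; first exact: zero_frequency_limit.
have [r /sub0 /= -> r2] := positive_frequency_limit S Xx0 R.
by have : (0 : R) < 2^-1 by []; rewrite ltNge r2.
Qed.
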